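(* Let $M\ge 1$ be an integer, let $R(x,\frac{d}{dx})=\sum_{m=0}^M r_m(x)\bigl(\frac{d}{dx}\bigr)^m$ be an $M$-th order differential operator whose coefficient functions $r_m$ $(m=0,1,\ldots,M)$ are rational functions, and assume that $R(x,\frac{d}{dx})$ has no singular points in $\mathbb{R}$. Let $k_0\in\mathbb{Z}$ and $\lambda\in\mathbb{C}$. Then a nonzero element $f\in L^2_{(k_0)}(\mathbb{R})$ is an eigenfunction of $A_{R,L^2_{(k_0)}(\mathbb{R})}$ with eigenvalue $\lambda$ if and only if $f$ belongs to $C^M(\mathbb{R})\cap L^2_{(k_0)}(\mathbb{R})$ and satisfies the ordinary differential equation $R(x,\frac{d}{dx})f(x)=\lambda f(x)$.
   Context: For $k_0\in\mathbb{Z}$, $L^2_{(k_0)}(\mathbb{R})$ is the Hilbert space of (a.e.-equivalence classes of) measurable functions $f:\mathbb{R}\to\mathbb{C}$ with $\|f\|_{(k_0)}^2=\int_{-\infty}^{\infty}|f(x)|^2(x^2+1)^{k_0}\,dx<\infty$, with inner product $\langle f,g\rangle_{(k_0)}=\int_{-\infty}^\infty f(x)\overline{g(x)}(x^2+1)^{k_0}\,dx$. An element of $L^2_{(k_0)}(\mathbb{R})$ is said to belong to $C^M(\mathbb{R})$ if it agrees a.e. with an $M$-times continuously differentiable function. The operator $\widetilde{A}_{R,L^2_{(k_0)}(\mathbb{R})}$ acts by $f\mapsto R(x,\frac{d}{dx})f$ on the domain $\{f\in C^M(\mathbb{R})\cap L^2_{(k_0)}(\mathbb{R}) : R(x,\frac{d}{dx})f\in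 L^2_{(k_0)}(\mathbb{R})\}$, and $A_{R,L^2_{(k_0)}(\mathbb{R})}$ is its closure with respect to the graph norm (i.e. the operator in $L^2_{(k_0)}(\mathbb{R})$ whose graph is the closure of the graph of $\widetilde{A}_{R,L^2_{(k_0)}(\mathbb{R})}$). Singular points: let $l(x)$ be the least common multiple of the denominators of the rational functions $r_m(x)$ $(m=0,\ldots,M)$. The set of singular points of $R(x,\frac{d}{dx})$ is the set $(l\cdot r_M)^{-1}(0)$ of real zeros of the polynomial $l(x)r_M(x)$ (equivalently, the real singular points of the equation $R(x,\frac{d}{dx})f=\lambda f$, a set which does not depend on $\lambda$). *)

(* Defs.v *)
From HB Require Import structures.
From mathcomp Require Import all_boot all_order all_algebra.
From mathcomp Require Import all_classical all_reals all_analysis.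
From mathcomp Require Import complex.

Set Implicit Arguments.
Unset Strict Implicit.
Unset Printing Implicit Defensive.

Import Order.TTheory GRing.Theory Num.Theory.
Import numFieldNormedType.Exports.

Local Open Scope classical_set_scope.
Local Open Scope ring_scope.

Lemma pi_mul_denom (D : idomainType) (y : {ratio D}) :
  (\pi_({fraction D})%qT y) * FracField.tofrac (frac y).2 =
  FracField.tofrac (frac y).1.
Proof.
have d0 : (frac y).2 != 0 by exact: denom_ratioP.
rewrite /FracField.tofrac; unlock.
transitivity (FracField.mul (\pi_({fraction D})%qT y)
  (\pi_({fraction D})%qT (Ratio (frac y).2 1))); first by [].
rewrite -FracField.pi_mul; apply/eqmodP.
rewrite /= FracField.equivfE /FracField.mulf.
by rewrite !numden_Ratio ?mulr1 ?mulf_neq0 ?oner_neq0// mulrC.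
Qed.

Section RationalFunctions.
Variable F : fieldType.
Implicit Types (p q m : {poly F}) (r : {fraction {poly F}}).

Local Notation rfrac p := (FracField.tofrac p).
Local Notation n_ r := (frac (repr r)).1.
Local Notation d_ r := (frac (repr r)).2.

(* The representative chosen by [repr] need not be in lowest terms, so its
   numerator and denominator are divided by their gcd; [rnum] and [rden] are
   thus determined by [r] up to a common nonzero constant factor. *)
Definition rnum r : {poly F} := n_ r %/ gcdp (n_ r) (d_ r).
Definition rden r : {poly F} := d_ r %/ gcdp (n_ r) (d_ r).

(* This is 0 at a pole of r, since 0^-1 = 0. *)
Definition reval r (x : F) : F := (rnum r).[x] / (rden r).[x].

Lemma rden_neq0 r : rden r != 0.
Proof. by rewrite dvdp_div_eq0 ?dvdp_gcdr ?denom_ratioP. Qed.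

Lemma coprime_rnum_rden r : coprimep (rnum r) (rden r).
Proof. by apply: coprimep_div_gcd; rewrite denom_ratioP orbT. Qed.

Lemma rnum_rdenE r : r = rfrac (rnum r) / rfrac (rden r).
Proof.
have d0 : d_ r != 0 by exact: denom_ratioP.
have g0 : gcdp (n_ r) (d_ r) != 0 by rewrite gcdp_eq0 negb_and d0 orbT.
have rE : r * rfrac (d_ r) = rfrac (n_ r).
  by have := pi_mul_denom (repr r); rewrite reprK.
apply: (canRL (mulfK _)); first by rewrite tofrac_eq0 rden_neq0.
apply: (mulIf (x := rfrac (gcdp (n_ r) (d_ r)))); first by rewrite tofrac_eq0.
by rewrite -mulrA -!tofracM !divpK ?dvdp_gcdl ?dvdp_gcdr.
Qed.

Definition lcmp p q : {poly F} := p %/ gcdp p q * q.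

Lemma dvdp_lcm p q m : (lcmp p q %| m) = (p %| m) && (q %| m).
Proof.
rewrite /lcmp; have [/eqP|g0] := eqVneq (gcdp p q) 0.
  by rewrite gcdp_eq0 => /andP[/eqP-> /eqP->]; rewrite mulr0 andbb.
have pE := divpK (dvdp_gcdl p q); have qE := divpK (dvdp_gcdr p q).
have c : coprimep (p %/ gcdp p q) (q %/ gcdp p q).
  by apply: coprimep_div_gcd; rewrite -negb_and -gcdp_eq0.
apply/idP/andP => [H|[pm qm]].
  split; apply: dvdp_trans H; last exact: dvdp_mulIr.
  by rewrite -{1}pE; apply: dvdp_mul => //; exact: dvdp_gcdr.
have /divpK mE : gcdp p q %| m by apply: dvdp_trans pm; exact: dvdp_gcdl.
rewrite -mE -{2}qE mulrA dvdp_mul2r// Gauss_dvdp//.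
by apply/andP; split; rewrite -(dvdp_mul2r _ _ g0) mE ?pE ?qE.
Qed.

End RationalFunctions.

Section DifferentialOperator.
Variables (R : realType) (M : nat).
Local Notation C := R[i].

(* The coefficient family r encodes \sum_(m <= M) r_m (d/dx)^m. *)
Variable r : 'I_M.+1 -> {fraction {poly C}}.

Definition lcm_den : {poly C} := \big[@lcmp C/1]_(m < M.+1) rden (r m).

(* The polynomial l * r_M; see lead_polyE. *)
Definition lead_poly : {poly C} :=
  lcm_den %/ rden (r ord_max) * rnum (r ord_max).

Definition singular_points : set R := [set x : R | root lead_poly x%:C%C].

Definition poles : set R := [set x : R | exists m, root (rden (r m)) x%:C%C].

Lemma dvdp_lcm_den p :
  reflect (forall m, rden (r m) %| p) (lcm_den %| p).
Proof.
suff -> : (lcm_den %| p) = all (fun m => rden (r m) %| p) (index_enum 'I_M.+1).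
  apply: (iffP allP) => H m => [|_]; last exact: H.
  by apply: H; rewrite mem_index_enum.
rewrite /lcm_den; elim: (index_enum _) => [|m s IH].
  by rewrite big_nil dvd1p.
by rewrite big_cons dvdp_lcm IH.
Qed.

Lemma lead_polyE :
  FracField.tofrac lead_poly = FracField.tofrac lcm_den * r ord_max.
Proof.
have /divpK lE : rden (r ord_max) %| lcm_den by exact/dvdp_lcm_den/dvdpp.
rewrite [r ord_max in RHS]rnum_rdenE -[in RHS]lE /lead_poly !tofracM.
rewrite -!mulrA; congr (_ * _); rewrite mulrC -mulrA mulVf ?mulr1//.
by rewrite tofrac_eq0 rden_neq0.
Qed.

Definition cderiven (n : nat) (f : R -> C) (x : R) : C :=
  Complex (derive1n n (fun t => complex.Re (f t)) x)
          (derive1n n (fun t => complex.Im (f t)) x).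

Definition real_Cn (n : nat) (u : R -> R) : Prop :=
  (forall (k : nat) (x : R), (k < n)%N -> derivable (derive1n k u) x 1) /\
  continuous (derive1n n u).

Definition Cn (n : nat) (f : R -> C) : Prop :=
  real_Cn n (fun t => complex.Re (f t)) /\
  real_Cn n (fun t => complex.Im (f t)).

(* Meaningful off the poles, hence almost everywhere. *)
Definition diffop (f : R -> C) (x : R) : C :=
  \sum_(m < M.+1) reval (r m) x%:C%C * cderiven m f x.

End DifferentialOperator.

(* Elements of the weighted L^2 space are represented by functions R -> R[i],
   two functions standing for the same element when they are equal a.e. *)
Section WeightedL2.
Variables (R : realType) (k0 : int).
Local Notation C := R[i].
Implicit Types f g h : R -> C.

Definition eq_ae f g : Prop :=
  {ae (@lebesgue_measure R), forall x, f x = g x}.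

Definition measurable_complex f : Prop :=
  measurable_fun [set: R] (fun x => complex.Re (f x)) /\
  measurable_fun [set: R] (fun x => complex.Im (f x)).

Definition sqnorm f : \bar R :=
  (\int[@lebesgue_measure R]_x
     (ComplexField.Normc.normc (f x) ^+ 2 * (x ^+ 2 + 1) ^ k0)%:E)%E.

Definition L2 f : Prop := measurable_complex f /\ (sqnorm f < +oo)%E.

(* Operators are given by their graphs, as subsets of the product of the
   weighted L^2 space with itself. *)
Definition graph_tilde M (r : 'I_M.+1 -> {fraction {poly C}}) :
    set ((R -> C) * (R -> C)) :=
  [set u | [/\ L2 u.1, L2 u.2 &
     exists h, [/\ Cn M h, eq_ae u.1 h & eq_ae u.2 (diffop r h)]]].

Definition graph_closure (G : set ((R -> C) * (R -> C))) :
    set ((R -> C) * (R -> C)) :=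
  [set u | [/\ L2 u.1, L2 u.2 & forall e : R, 0 < e ->
     exists2 v, G v &
       (sqnorm (u.1 \- v.1)%R + sqnorm (u.2 \- v.2)%R < (e ^+ 2)%:E)%E]].

Definition graph_op M (r : 'I_M.+1 -> {fraction {poly C}}) :=
  graph_closure (graph_tilde r).

Definition eigenfunction (G : set ((R -> C) * (R -> C))) (lambda : C) f :
    Prop :=
  [/\ L2 f, ~ eq_ae f (fun=> 0) & G (f, fun x => lambda * f x)].

End WeightedL2.

(* Main.v *)
Require Import Defs.
From mathcomp Require Import all_boot all_order all_algebra.
From mathcomp Require Import all_classical all_reals all_analysis.
From mathcomp Require Import measurable_realfun complex.
From mathcomp Require Import ring lra.

Import Order.TTheory GRing.Theory Num.Theory.
Import numFieldNormedType.Exports.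

Local Open Scope classical_set_scope.
Local Open Scope ring_scope.

(** A solution in the classical sense is trivially in the domain of the
    operator before closure, so only the regularity of eigenfunctions of the
    closure has content. Write [l] for the common denominator of the
    coefficients. Since [l * r_M] has no real zeros, multiplying
    [R h - lambda h] by [l / (l * r_M)] turns it into [L h] for a monic operator
    [L] with continuous coefficients ([cleared_opE]). An eigenfunction [f] comes
    with functions [h n] of class [C^M] such that [h n] tends to [f] and
    [L (h n)] tends to 0 in [L1] on every bounded interval, because the weight
    is bounded below there ([sqnorm_L1_le]).

    The key is the a priori estimate [monic_op_bound]: on [`[- N, N]] all
    derivatives of [h] of order less than [M] are uniformly bounded by a
    constant times the [L1] norms of [h] and [L h]. It follows from an elementary
    interpolation inequality on short intervals ([deriv_bound]), where the terms
    of [L] of lower order can be absorbed. No solutions of the differential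
    equation have to be constructed. Applied to the differences [h n - h k], the
    estimate shows that the derivatives of order less than [M] converge locally
    uniformly; then the derivatives of order [M] converge in [L1], because
    [L (h n)] does, towards a continuous function. By the fundamental theorem of
    calculus ([limit_is_derive]) each limit is the derivative of the previous
    one. Hence the limit [g] of [h n] is of class [C^M], satisfies [L g = 0], and
    agrees with [f] almost everywhere ([monic_op_kernel_closed]). *)

Set Implicit Arguments.
Unset Strict Implicit.
Unset Printing Implicit Defensive.

(** * Integral bounds on intervals *)

Section L1Bounds.
Variable R : realType.
Local Notation mu := (@lebesgue_measure R).
Implicit Types (a b c d B : R) (u v : R -> R).

(** Carrying a real upper bound instead of the integral itself keeps the
    estimates out of the extended reals and makes finiteness implicit. *)
Definition L1_le a b u B : Prop :=
  measurable_fun [set: R] u /\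
  (\int[mu]_(x in `[a, b]) `|u x|%:E <= B%:E)%E.

Lemma ae_mono2 (P Q S : R -> Prop) :
  {ae mu, forall x, P x} -> {ae mu, forall x, Q x} ->
  (forall x, P x -> Q x -> S x) -> {ae mu, forall x, S x}.
Proof.
move=> aeP aeQ PQS.
exact: (@filterS2 _ _ (ae_filter_ringOfSetsType mu) P Q S PQS).
Qed.

Lemma measurable_norm_EFin u (D : set R) :
  measurable_fun [set: R] u -> measurable_fun D (fun x => `|u x|%:E).
Proof.
move=> mu_u; apply: (@measurable_funS _ _ _ _ setT) => //.
exact/measurable_EFinP/measurableT_comp.
Qed.

Lemma L1_le_ae a b u v B : measurable_fun [set: R] u ->
  {ae mu, forall x, x \in `[a, b] -> `|u x| <= `|v x|} ->
  L1_le a b v B -> L1_le a b u B.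
Proof.
move=> mu_u uv [mv vB]; split=> //; apply: le_trans vB.
apply: ae_ge0_le_integral => //; exact: measurable_norm_EFin.
Qed.

Lemma L1_le_mono a b u v B : measurable_fun [set: R] u ->
  (forall x, x \in `[a, b] -> `|u x| <= `|v x|) ->
  L1_le a b v B -> L1_le a b u B.
Proof. by move=> mu_u uv; apply: L1_le_ae => //; apply: aeW. Qed.

Lemma L1_leD a b u v B B' : L1_le a b u B -> L1_le a b v B' ->
  L1_le a b (fun x => `|u x| + `|v x|) (B + B').
Proof.
move=> [mu_u uB] [mv vB]; split.
  by apply: measurable_funD; exact: measurableT_comp.
rewrite EFinD; apply: le_trans (leeD uB vB).
rewrite -ge0_integralD//; [|exact: measurable_norm_EFin..].
apply: ge0_le_integral => //.
- by apply: measurable_norm_EFin; apply: measurable_funD; exact: measurableT_comp.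
- by apply: emeasurable_funD; exact: measurable_norm_EFin.
- by move=> x _; rewrite -EFinD lee_fin ger0_norm// addr_ge0.
Qed.

Lemma L1_leZ a b k u B : L1_le a b u B ->
  L1_le a b (fun x => k * u x) (`|k| * B).
Proof.
move=> [mu_u uB]; split; first exact: measurable_funM.
under eq_integral do rewrite normrM EFinM.
rewrite ge0_integralZl//; last exact: measurable_norm_EFin.
by rewrite EFinM lee_wpmul2l// lee_fin.
Qed.

Lemma L1_le_sub a b c d u B : a <= c -> d <= b ->
  L1_le a b u B -> L1_le c d u B.
Proof.
move=> ac db [mu_u uB]; split=> //; apply: le_trans uB.
apply: ge0_subset_integral => //; first exact: measurable_norm_EFin.
by apply: subset_itv; rewrite bnd_simp.
Qed.

Lemma L1_le_widen a b u B B' : B <= B' -> L1_le a b u B -> L1_le a b u B'.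
Proof.
by move=> BB' [mu_u uB]; split=> //; apply: le_trans uB _; rewrite lee_fin.
Qed.

Lemma L1_le_cst a b k : a <= b -> L1_le a b (cst k) (`|k| * (b - a)).
Proof.
move=> ab; split; first exact: measurable_cst.
have -> : (fun x : R => `|cst k x|%:E) = cst `|k|%:E by [].
rewrite integral_cst//= lebesgue_measure_itv/= lte_fin.
by case: ltgtP ab => // -> _; rewrite subrr mulr0 mule0.
Qed.

Lemma L1_le_bounded a b u k : a <= b -> measurable_fun [set: R] u ->
  (forall x, x \in `[a, b] -> `|u x| <= k) -> L1_le a b u (k * (b - a)).
Proof.
move=> ab mu_u uk; have k0 : 0 <= k.
  by apply: le_trans (uk a _); rewrite ?in_itv/= ?lexx.
have := L1_le_cst k ab; rewrite ger0_norm//; apply: L1_le_mono => // x xab.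
by rewrite [leRHS]ger0_norm//; exact: uk.
Qed.

Lemma L1_le_ge0 a b u B : L1_le a b u B -> 0 <= B.
Proof. by move=> [_ uB]; rewrite -lee_fin (le_trans _ uB)// integral_ge0. Qed.

Lemma continuous_measurable u (D : set R) : continuous u -> measurable_fun D u.
Proof.
by move=> cu; apply: (@measurable_funS _ _ _ _ setT) => //;
  exact: continuous_measurable_fun.
Qed.

Lemma continuous_bounded a b u : a <= b -> continuous u ->
  exists2 k, 0 < k & forall x, x \in `[a, b] -> `|u x| <= k.
Proof.
move=> ab cu.
have cn : {within `[a, b], continuous (fun x => `|u x|)}.
  apply: continuous_subspaceT => x; apply: continuous_comp; first exact: cu.
  exact: norm_continuous.
have [c cab uc] := EVT_max ab cn.
exists (`|u c| + 1); first by rewrite ltr_wpDl.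
by move=> x xab; rewrite (le_trans (uc x xab))// lerDl.
Qed.

(** The minimum of [`|u|], which is attained because [u] is continuous, is at
    most the average. *)
Lemma exists_le_average a b u B : a < b -> continuous u -> L1_le a b u B ->
  exists2 x, x \in `[a, b] & `|u x| <= (b - a)^-1 * B.
Proof.
move=> ab cu uB.
have cn : {within `[a, b], continuous (fun x => `|u x|)}.
  apply: continuous_subspaceT => x; apply: continuous_comp; first exact: cu.
  exact: norm_continuous.
have [c cab uc] := EVT_min (ltW ab) cn.
exists c => //; rewrite mulrC ler_pdivlMr ?subr_gt0//.
have [_ +] : L1_le a b (cst (u c)) B.
  by apply: L1_le_mono uB; [exact: measurable_cst|move=> x /uc].
have -> : (fun x : R => `|cst (u c) x|%:E) = cst `|u c|%:E by [].
by rewrite integral_cst//= lebesgue_measure_itv/= lte_fin ab -EFinB -EFinM lee_fin.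
Qed.

Lemma derivable_continuous u : (forall x, derivable u x 1) -> continuous u.
Proof. by move=> du x; apply/differentiable_continuous/derivable1_diffP. Qed.

Lemma mvt_le a b u k : a <= b -> (forall x, derivable u x 1) ->
  (forall x, x \in `[a, b] -> `|derive1 u x| <= k) ->
  `|u b - u a| <= k * (b - a).
Proof.
move=> ab du uk.
have cu : {within `[a, b], continuous u}.
  by apply: continuous_subspaceT; exact: derivable_continuous.
have [x xab ->] := @MVT_segment _ u (derive1 u) a b ab
  (fun x _ => DeriveDef (du x) (esym (derive1E _ _))) cu.
by rewrite normrM [`|b - a|]ger0_norm ?subr_ge0// ler_wpM2r ?subr_ge0 ?uk.
Qed.

Lemma ftc_le a b u f B : a <= b ->
  (forall x, x \in `[a, b] -> is_derive x 1 u (f x)) -> continuous f ->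
  L1_le a b f B -> `|u b - u a| <= B.
Proof.
move=> ab uf cf fB; have B0 := L1_le_ge0 fB.
move: ab; rewrite le_eqVlt => /predU1P[<-|ab]; first by rewrite subrr normr0.
have cu x : x \in `[a, b] -> {for x, continuous u}.
  move=> xab; apply/differentiable_continuous/derivable1_diffP.
  by have [] := uf x xab.
have aab : a \in `[a, b] by rewrite in_itv/= lexx ltW.
have bab : b \in `[a, b] by rewrite in_itv/= lexx ltW.
have uE : (\int[mu]_(x in `[a, b]) (f x)%:E = (u b)%:E - (u a)%:E)%E.
  apply: continuous_FTC2 => //; first exact: continuous_subspaceT.
  split.
  - by move=> x /subset_itv_oo_cc xab; have [] := uf x xab.
  - by apply: cvg_at_right_filter; exact: cu.
  - by apply: cvg_at_left_filter; exact: cu.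
  move=> x /subset_itv_oo_cc xab; rewrite derive1E.
  exact: (@derive_val _ _ _ _ _ _ _ (uf x xab)).
rewrite -lee_fin -abse_EFin EFinB -uE.
apply: le_trans fB.2; apply: le_abse_integral => //.
by apply/measurable_EFinP; exact: continuous_measurable.
Qed.

End L1Bounds.

(** * Interpolation of derivatives *)

Section RealInterpolation.
Variable R : realType.
Implicit Types (a b d x B E : R) (u v : R -> R) (m n k : nat).

Lemma real_CnW n k u : (k <= n)%N -> real_Cn n u -> real_Cn k u.
Proof.
move=> kn [du cu]; split=> [j x jk|]; first exact: du (leq_trans jk kn).
move: kn; rewrite leq_eqVlt => /predU1P[->//|kn].
by apply: derivable_continuous => x; exact: du.
Qed.

Lemma real_Cn_cont n k u : real_Cn n u -> (k <= n)%N -> continuous (derive1n k u).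
Proof. by move=> nu kn; have [_] := real_CnW kn nu. Qed.

Lemma real_CnB n u v : real_Cn n u -> real_Cn n v ->
  (forall k, (k <= n)%N ->
    derive1n k (u \- v) = derive1n k u \- derive1n k v) /\ real_Cn n (u \- v).
Proof.
move=> nu nv.
have E k : (k <= n)%N -> derive1n k (u \- v) = derive1n k u \- derive1n k v.
  elim: k => [//|k IH] kn; rewrite !derive1nS IH ?(ltnW kn)//.
  apply/funext => x; rewrite /= !derive1E.
  by apply: deriveB; [exact: nu.1|exact: nv.1].
split=> //; split=> [k x kn|].
  rewrite E ?(ltnW kn)//.
  have -> : derive1n k u \- derive1n k v = derive1n k u - derive1n k v by [].
  by apply: derivableB; [exact: nu.1|exact: nv.1].
rewrite E// => x; apply: continuousB; [exact: nu.2|exact: nv.2].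
Qed.

(** The recursion mirrors the proof of [exists_deriv_bound]: an interval of
    length [d] is cut into thirds, and two values of the derivative of order [k],
    taken in the outer thirds, give a difference quotient over a distance of at
    least [d / 3]. *)
Fixpoint interp_cst m d : R :=
  if m is k.+1 then 2 * interp_cst k (d / 3) / (d / 3) else d^-1.

Lemma interp_cst_ge0 m d : 0 < d -> 0 <= interp_cst m d.
Proof.
elim: m d => [|m IH] d d0 /=; first by rewrite invr_ge0 ltW.
have d3 : 0 < d / 3 by rewrite divr_gt0.
by rewrite divr_ge0 ?mulr_ge0 ?IH// ltW.
Qed.

(** A derivative cannot be large on a whole interval when the function has
    small integral there. By induction on the order, there are points of the
    left and of the right third where the derivative of order [m] is small, and
    the mean value theorem between them gives a point where the derivative of
    order [m.+1] is small. *)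
Lemma exists_deriv_bound m u a b B : a < b -> real_Cn m u -> L1_le a b u B ->
  exists2 x, x \in `[a, b] & `|derive1n m u x| <= interp_cst m (b - a) * B.
Proof.
elim: m a b => [|m IH] a b ab nu uB; first exact: exists_le_average nu.2 uB.
pose d := (b - a) / 3.
have d0 : 0 < d by rewrite divr_gt0// subr_gt0.
have bad : b - a = 3 * d by rewrite /d mulrC divfK.
have nu' := real_CnW (leqnSn m) nu.
have [||s] := IH a (a + d) _ nu'; [by lra|by apply: L1_le_sub uB; lra|].
have -> : a + d - a = d by lra.
rewrite in_itv/= => /andP[as_ sd] us.
have [||t] := IH (b - d) b _ nu'; [by lra|by apply: L1_le_sub uB; lra|].
have -> : b - (b - d) = d by lra.
rewrite in_itv/= => /andP[dt tb] ut.
have st : s <= t by lra.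
have [c cst_ Ec] := @MVT_segment _ (derive1n m u) (derive1n m.+1 u) s t st
  (fun x _ => DeriveDef (nu.1 m x (ltnSn m)) (esym (derive1E _ _)))
  (continuous_subspaceT nu'.2).
exists c.
  move: cst_; rewrite !in_itv/= => /andP[sc ct].
  by apply/andP; split; lra.
rewrite [interp_cst _ _]/= -/d [leRHS]mulrAC ler_pdivlMr//.
have K0 := interp_cst_ge0 m d0.
apply: (@le_trans _ _ (`|derive1n m u t - derive1n m u s|)).
  rewrite Ec normrM ler_wpM2l//.
  by rewrite ger0_norm ?subr_ge0//; lra.
apply: le_trans (ler_normB _ _) _; lra.
Qed.

Definition interp_sum m n d : R := \sum_(m <= j < n) interp_cst j d.

Lemma interp_sum_ge0 m n d : 0 < d -> 0 <= interp_sum m n d.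
Proof. by move=> d0; apply: sumr_ge0 => j _; exact: interp_cst_ge0. Qed.

(** Downward induction on [m]: the derivative of order [m] is small at one
    point and varies by at most the bound on the next derivative, because the
    interval has length at most 1. At the top order the fundamental theorem of
    calculus replaces the mean value theorem, since only the integral of the
    derivative of order [n] is controlled. *)
Lemma deriv_bound_tail n u a b B E k m : a < b -> b - a <= 1 ->
  real_Cn n u -> L1_le a b u B -> L1_le a b (derive1n n u) E ->
  (m + k).+1 = n -> forall x, x \in `[a, b] ->
  `|derive1n m u x| <= interp_sum m n (b - a) * B + E.
Proof.
move=> ab ba1 nu uB uE; have ba0 : 0 < b - a by rewrite subr_gt0.
have B0 := L1_le_ge0 uB; have E0 := L1_le_ge0 uE.
elim: k m => [|k IH] m mk x xab.
- move: mk; rewrite addn0 => mk.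
  have mn : (m < n)%N by rewrite mk.
  have [y yab uy] := exists_deriv_bound ab (real_CnW (ltnW mn) nu) uB.
  suff : `|derive1n m u x - derive1n m u y| <= E.
    rewrite /interp_sum -mk big_nat1 => xy.
    rewrite -[X in `|X|](subrK (derive1n m u y)) (le_trans (ler_normD _ _))//.
    by rewrite addrC lerD.
  wlog yx : x y xab yab {uy} / y <= x.
    by move=> W; have /orP[?|?] := le_total y x; [|rewrite distrC]; exact: W.
  move: xab yab; rewrite !in_itv/= => /andP[ax xb] /andP[ay yb].
  apply: (@ftc_le _ y x _ (derive1n n u)) => //.
  + move=> z _; rewrite -mk derive1nS; apply: DeriveDef; first exact: nu.1.
    by rewrite derive1E.
  + exact: nu.2.
  + exact: L1_le_sub uE.
- have mn : (m.+1 < n)%N by rewrite -mk addnS !ltnS leq_addr.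
  have [y yab uy] := exists_deriv_bound ab (real_CnW (ltnW (ltnW mn)) nu) uB.
  have {}IH := IH m.+1 _; rewrite addSnnS in IH; have {}IH := IH mk.
  set D := interp_sum m.+1 n (b - a) * B + E in IH.
  suff : `|derive1n m u x - derive1n m u y| <= D.
    rewrite /interp_sum big_ltn ?(ltnW mn)// mulrDl -addrA => xy.
    rewrite -[X in `|X|](subrK (derive1n m u y)) (le_trans (ler_normD _ _))//.
    by rewrite addrC lerD.
  wlog yx : x y xab yab {uy} / y <= x.
    by move=> W; have /orP[?|?] := le_total y x; [|rewrite distrC]; exact: W.
  move: xab yab; rewrite !in_itv/= => /andP[ax xb] /andP[ay yb].
  have D0 : 0 <= D by rewrite addr_ge0// mulr_ge0// interp_sum_ge0.
  apply: (@le_trans _ _ (D * (x - y))).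
    apply: mvt_le => //; first by move=> z; apply: nu.1; exact: ltnW.
    by move=> z; rewrite in_itv/= => /andP[yz zx]; apply: IH; rewrite in_itv/=; lra.
  by rewrite ler_piMr//; lra.
Qed.

(** The coefficient of [E] does not grow when the interval shrinks; this is
    what allows the terms of lower order of a differential operator to be
    absorbed in [monic_op_bound_short]. *)
Lemma deriv_bound n u a b B E m : a < b -> b - a <= 1 ->
  real_Cn n u -> L1_le a b u B -> L1_le a b (derive1n n u) E ->
  (m < n)%N -> forall x, x \in `[a, b] ->
  `|derive1n m u x| <= interp_sum 0 n (b - a) * B + E.
Proof.
move=> ab ba1 nu uB uE mn x xab; have B0 := L1_le_ge0 uB.
have := @deriv_bound_tail n u a b B E (n - m.+1) m ab ba1 nu uB uE _ x xab.
rewrite -addSn subnKC// => /(_ erefl)/le_trans; apply.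
rewrite lerD2r ler_wpM2r// /interp_sum (@big_cat_nat _ _ _ m 0)//=; last first.
  exact: ltnW.
by rewrite lerDr; apply: interp_sum_ge0; rewrite subr_gt0.
Qed.

End RealInterpolation.

(** * Complex-valued functions of a real variable *)

Section ComplexFunctions.
Variable R : realType.
Local Notation C := R[i].
Implicit Types (x y z w : C) (f g h : R -> C).

(** Equivalent to the modulus, but its integral splits into those of the real
    and imaginary parts, for which the mean value theorem is available. *)
Definition norm1 z : R := `|complex.Re z| + `|complex.Im z|.

Lemma norm1_ge0 z : 0 <= norm1 z.
Proof. by rewrite addr_ge0. Qed.

Lemma norm10 : norm1 0 = 0.
Proof. by rewrite /norm1 /= !normr0 addr0. Qed.

Lemma norm1N z : norm1 (- z) = norm1 z.
Proof. by case: z => a b; rewrite /norm1 /= !normrN. Qed.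

Lemma norm1D z w : norm1 (z + w) <= norm1 z + norm1 w.
Proof.
case: z w => [a b] [c d]; rewrite /norm1 /= addrACA.
by rewrite lerD// ler_normD.
Qed.

Lemma norm1B z w : norm1 (z - w) <= norm1 z + norm1 w.
Proof. by rewrite -(norm1N w) norm1D. Qed.

Lemma norm1_distC z w : norm1 (z - w) = norm1 (w - z).
Proof. by rewrite -norm1N opprB. Qed.

Lemma norm1M z w : norm1 (z * w) <= norm1 z * norm1 w.
Proof.
case: z w => [a b] [c d]; rewrite /norm1 /=.
apply: (@le_trans _ _ (`|a * c| + `|b * d| + (`|a * d| + `|b * c|))).
  by rewrite lerD// ?ler_normD// (le_trans (ler_normB _ _)).
by rewrite !normrM; lra.
Qed.

Lemma norm1_sum (I : Type) (s : seq I) (P : pred I) (F : I -> C) :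
  norm1 (\sum_(i <- s | P i) F i) <= \sum_(i <- s | P i) norm1 (F i).
Proof.
elim/big_ind2: _ => [|u a v b ua vb|//]; first by rewrite norm10.
by rewrite (le_trans (norm1D _ _))// lerD.
Qed.

Lemma norm1_eq0 z : norm1 z = 0 -> z = 0.
Proof.
case: z => a b /eqP; rewrite /norm1 /= paddr_eq0// !normr_eq0.
by move=> /andP[/eqP-> /eqP->].
Qed.

Lemma Re_le_norm1 z : `|complex.Re z| <= norm1 z.
Proof. by rewrite lerDl. Qed.

Lemma Im_le_norm1 z : `|complex.Im z| <= norm1 z.
Proof. by rewrite lerDr. Qed.

Lemma ReB z w : complex.Re (z - w) = complex.Re z - complex.Re w.
Proof. by case: z w => [? ?] []. Qed.

Lemma ImB z w : complex.Im (z - w) = complex.Im z - complex.Im w.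
Proof. by case: z w => [? ?] []. Qed.

Definition ccontinuous f : Prop :=
  continuous (fun t => complex.Re (f t)) /\
  continuous (fun t => complex.Im (f t)).

Lemma ccontinuous_cst z : ccontinuous (fun=> z).
Proof. by split=> t; exact: cvg_cst. Qed.

Lemma ccontinuousD f g : ccontinuous f -> ccontinuous g ->
  ccontinuous (fun t => f t + g t).
Proof.
move=> [rf jf] [rg jg]; split=> t.
  have -> : (fun t => complex.Re (f t + g t)) =
            (fun t => complex.Re (f t) + complex.Re (g t)).
    by apply/funext => s; case: (f s) (g s) => [? ?] [].
  by apply: continuousD; [exact: rf|exact: rg].
have -> : (fun t => complex.Im (f t + g t)) =
          (fun t => complex.Im (f t) + complex.Im (g t)).
  by apply/funext => s; case: (f s) (g s) => [? ?] [].
by apply: continuousD; [exact: jf|exact: jg].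
Qed.

Lemma ccontinuousM f g : ccontinuous f -> ccontinuous g ->
  ccontinuous (fun t => f t * g t).
Proof.
move=> [rf jf] [rg jg]; split=> t.
  have -> : (fun t => complex.Re (f t * g t)) =
            (fun t => complex.Re (f t) * complex.Re (g t) -
                      complex.Im (f t) * complex.Im (g t)).
    by apply/funext => s; case: (f s) (g s) => [? ?] [].
  by apply: cvgB; apply: cvgM;
    [exact: rf|exact: rg|exact: jf|exact: jg].
have -> : (fun t => complex.Im (f t * g t)) =
          (fun t => complex.Re (f t) * complex.Im (g t) +
                    complex.Im (f t) * complex.Re (g t)).
  by apply/funext => s; case: (f s) (g s) => [? ?] [].
by apply: cvgD; apply: cvgM;
  [exact: rf|exact: jg|exact: jf|exact: rg].
Qed.

Lemma ccontinuousN f : ccontinuous f -> ccontinuous (fun t => - f t).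
Proof.
move=> cf; have -> : (fun t => - f t) = (fun t => (-1) * f t).
  by apply/funext => t; rewrite mulN1r.
by apply: ccontinuousM => //; exact: ccontinuous_cst.
Qed.

Lemma ccontinuousV f : ccontinuous f -> (forall t, f t != 0) ->
  ccontinuous (fun t => (f t)^-1).
Proof.
move=> [rf jf] f0.
pose n t := complex.Re (f t) * complex.Re (f t) +
  complex.Im (f t) * complex.Im (f t).
have n0 t : n t != 0.
  apply: contra (f0 t); rewrite /n -!expr2 paddr_eq0 ?sqr_ge0// !sqrf_eq0.
  by case: (f t) => a b /= /andP[/eqP-> /eqP->].
have cn : continuous n.
  by move=> t; apply: cvgD; apply: cvgM; [exact: rf|exact: rf|exact: jf|exact: jf].
have cV : continuous (fun t => (n t)^-1).
  by move=> t; apply: cvgV; [exact: n0|exact: cn].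
split=> t.
  have -> : (fun t => complex.Re (f t)^-1) =
            (fun t => complex.Re (f t) * (n t)^-1).
    by apply/funext => s; rewrite /n -!expr2; case: (f s).
  by apply: cvgM; [exact: rf|exact: cV].
have -> : (fun t => complex.Im (f t)^-1) =
          (fun t => - (complex.Im (f t) * (n t)^-1)).
  by apply/funext => s; rewrite /n -!expr2; case: (f s).
by apply: cvgN; apply: cvgM; [exact: jf|exact: cV].
Qed.

Lemma ccontinuous_sum n (F : 'I_n -> R -> C) :
  (forall i, ccontinuous (F i)) -> ccontinuous (fun t => \sum_(i < n) F i t).
Proof.
elim: n F => [|n IH] F cF.
  under eq_fun do rewrite big_ord0; exact: ccontinuous_cst.
under eq_fun do rewrite big_ord_recr/=.
by apply: ccontinuousD => //; exact: IH.
Qed.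

Lemma ccontinuous_horner (p : {poly C}) :
  ccontinuous (fun t : R => p.[t%:C%C]).
Proof.
elim/poly_ind: p => [|p c IH].
  under eq_fun do rewrite horner0; exact: ccontinuous_cst.
under eq_fun do rewrite hornerMXaddC.
apply: ccontinuousD; last exact: ccontinuous_cst.
apply: ccontinuousM => //; split=> t; first exact: cvg_id.
exact: cvg_cst.
Qed.

Lemma ccontinuous_measurable f : ccontinuous f -> measurable_complex f.
Proof. by move=> [rf jf]; split; exact: continuous_measurable. Qed.

Lemma measurable_norm1 f : measurable_complex f ->
  measurable_fun [set: R] (fun t => norm1 (f t)).
Proof.
by move=> [rf jf]; apply: measurable_funD; exact: measurableT_comp.
Qed.

Lemma ccontinuous_norm1 f : ccontinuous f -> continuous (fun t => norm1 (f t)).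
Proof.
move=> [rf jf] t; apply: cvgD.
  by apply: continuous_comp; [exact: rf|exact: norm_continuous].
by apply: continuous_comp; [exact: jf|exact: norm_continuous].
Qed.

Lemma measurable_complexB f g : measurable_complex f -> measurable_complex g ->
  measurable_complex (fun t => f t - g t).
Proof.
move=> [rf jf] [rg jg]; split.
  by under eq_fun do rewrite ReB; exact: measurable_funB.
by under eq_fun do rewrite ImB; exact: measurable_funB.
Qed.

Lemma measurable_complexM f g : measurable_complex f -> measurable_complex g ->
  measurable_complex (fun t => f t * g t).
Proof.
move=> [rf jf] [rg jg]; split.
  have -> : (fun t => complex.Re (f t * g t)) =
            (fun t => complex.Re (f t) * complex.Re (g t) -
                      complex.Im (f t) * complex.Im (g t)).
    by apply/funext => s; case: (f s) (g s) => [? ?] [].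
  by apply: measurable_funB; exact: measurable_funM.
have -> : (fun t => complex.Im (f t * g t)) =
          (fun t => complex.Re (f t) * complex.Im (g t) +
                    complex.Im (f t) * complex.Re (g t)).
  by apply/funext => s; case: (f s) (g s) => [? ?] [].
by apply: measurable_funD; exact: measurable_funM.
Qed.

Lemma Cn_ccontinuous n k h : Cn n h -> (k <= n)%N ->
  ccontinuous (cderiven k h).
Proof. by move=> [rh jh] kn; split; exact: real_Cn_cont kn. Qed.

Lemma CnB n f g : Cn n f -> Cn n g ->
  (forall k, (k <= n)%N -> forall t,
    cderiven k (fun s => f s - g s) t = cderiven k f t - cderiven k g t) /\
  Cn n (fun s => f s - g s).
Proof.
move=> [rf jf] [rg jg].
have [rE rC] := real_CnB rf rg; have [jE jC] := real_CnB jf jg.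
rewrite /Cn /cderiven.
have -> : (fun t => complex.Re (f t - g t)) =
  (fun t => complex.Re (f t)) \- (fun t => complex.Re (g t)).
  by apply/funext => t; rewrite ReB.
have -> : (fun t => complex.Im (f t - g t)) =
  (fun t => complex.Im (f t)) \- (fun t => complex.Im (g t)).
  by apply/funext => t; rewrite ImB.
by split=> // k kn t; rewrite rE// jE.
Qed.

End ComplexFunctions.

(** * A priori estimate for monic operators *)

Section APrioriEstimate.
Variables (R : realType) (M : nat).
Local Notation C := R[i].
Local Notation mu := (@lebesgue_measure R).
Implicit Types (a b d x B W E N Q : R) (f g h : R -> C).

Definition monic_op (c : nat -> R -> C) h x : C :=
  \sum_(m < M) c m x * cderiven m h x + cderiven M h x.

Lemma continuous_L1_least a b (u : R -> R) : a <= b -> continuous u ->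
  exists2 E, L1_le a b u E & forall E', L1_le a b u E' -> E <= E'.
Proof.
move=> ab cu; have [k k0 uk] := continuous_bounded ab cu.
have mu_u : measurable_fun [set: R] u by exact: continuous_measurable.
have [_ ubd] := L1_le_bounded ab mu_u uk.
have fin_u : (\int[mu]_(x in `[a, b]) `|u x|%:E)%E \is a fin_num.
  rewrite ge0_fin_numE ?integral_ge0//.
  by apply: le_lt_trans ubd _; rewrite ltry.
exists (fine (\int[mu]_(x in `[a, b]) `|u x|%:E)%E).
  by split=> //; rewrite fineK.
by move=> E' [_ uE']; rewrite -lee_fin fineK.
Qed.

(** The equation bounds the integral of the derivative of order [M] by [W]
    plus [M * Q * (b - a)] times a bound [D] on the lower derivatives, and
    [deriv_bound] bounds [D] by the integral of [h] plus that same integral.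
    On a short interval the second contribution is absorbed. *)
Lemma monic_op_bound_short (c : nat -> R -> C) h a b Q B W : a < b -> b - a <= 1 ->
  Cn M h -> 0 <= Q ->
  (forall m x, (m < M)%N -> x \in `[a, b] -> norm1 (c m x) <= Q) ->
  M%:R * Q * (b - a) <= 4^-1 ->
  L1_le a b (fun x => norm1 (h x)) B ->
  L1_le a b (fun x => norm1 (monic_op c h x)) W ->
  forall m x, (m < M)%N -> x \in `[a, b] ->
    norm1 (cderiven m h x) <= 4 * interp_sum 0 M (b - a) * B + 4 * W.
Proof.
move=> ab ba1 hC Q0 cQ small hB hW; have ba0 : 0 < b - a by rewrite subr_gt0.
set K := interp_sum 0 M (b - a); have K0 : 0 <= K by exact: interp_sum_ge0.
have B0 := L1_le_ge0 hB; have W0 := L1_le_ge0 hW.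
have [hr hj] := hC.
have [Er rE rmin] := continuous_L1_least (ltW ab) hr.2.
have [Ej jE jmin] := continuous_L1_least (ltW ab) hj.2.
have Er0 := L1_le_ge0 rE; have Ej0 := L1_le_ge0 jE.
have rB : L1_le a b (fun x => complex.Re (h x)) B.
  apply: L1_le_mono hB.
    by apply: continuous_measurable; exact: real_Cn_cont hr (leq0n _).
  by move=> x _; rewrite [leRHS]ger0_norm ?norm1_ge0// Re_le_norm1.
have jB : L1_le a b (fun x => complex.Im (h x)) B.
  apply: L1_le_mono hB.
    by apply: continuous_measurable; exact: real_Cn_cont hj (leq0n _).
  by move=> x _; rewrite [leRHS]ger0_norm ?norm1_ge0// Im_le_norm1.
pose D := 2 * K * B + (Er + Ej).
have D0 : 0 <= D by rewrite /D; nra.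
have hD m x : (m < M)%N -> x \in `[a, b] -> norm1 (cderiven m h x) <= D.
  move=> mM xab; rewrite /norm1 /=.
  have := deriv_bound ab ba1 hr rB rE mM xab.
  have := deriv_bound ab ba1 hj jB jE mM xab.
  rewrite -/K /D; lra.
have hM x : x \in `[a, b] ->
    norm1 (cderiven M h x) <= norm1 (monic_op c h x) + M%:R * Q * D.
  move=> xab; have -> : cderiven M h x =
      monic_op c h x - \sum_(m < M) c m x * cderiven m h x.
    by rewrite /monic_op addrAC subrr add0r.
  apply: le_trans (norm1B _ _) _; rewrite lerD2l.
  apply: le_trans (norm1_sum _ _ _) _.
  apply: (@le_trans _ _ (\sum_(m < M) Q * D)).
    apply: ler_sum => m _; apply: le_trans (norm1M _ _) _.
    by apply: ler_pM; rewrite ?norm1_ge0 ?cQ ?hD.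
  by rewrite sumr_const card_ord -(mulr_natl (Q * D)) mulrA.
have MQD0 : 0 <= M%:R * Q * D by rewrite !mulr_ge0.
have bound : L1_le a b
    (fun x => `|norm1 (monic_op c h x)| + `|cst (M%:R * Q * D) x|)
    (W + `|M%:R * Q * D| * (b - a)).
  by apply: L1_leD => //; apply: L1_le_cst; exact: ltW.
have le_bound (u : R -> R) : continuous u ->
    (forall x, `|u x| <= norm1 (cderiven M h x)) ->
    L1_le a b u (W + `|M%:R * Q * D| * (b - a)).
  move=> cu uh; apply: L1_le_mono bound; first exact: continuous_measurable.
  move=> x xab; rewrite [leRHS]ger0_norm ?addr_ge0// (le_trans (uh x))//.
  rewrite (le_trans (hM x xab))// [`|norm1 _|]ger0_norm ?norm1_ge0//.
  by rewrite lerD2l/= ler_norm.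
have := rmin _ (le_bound _ hr.2 (fun x => Re_le_norm1 (cderiven M h x))).
have := jmin _ (le_bound _ hj.2 (fun x => Im_le_norm1 (cderiven M h x))).
rewrite ger0_norm// => Ejle Erle m x mM xab.
apply: le_trans (hD m x mM xab) _.
have : M%:R * Q * D * (b - a) <= 4^-1 * D.
  by rewrite mulrAC ler_wpM2r.
have DE : D = 2 * (K * B) + (Er + Ej) by rewrite mulrA.
rewrite -mulrA; lra.
Qed.

Lemma coefs_bounded n (c : nat -> R -> C) a b : a <= b ->
  (forall m, (m < n)%N -> ccontinuous (c m)) ->
  exists2 Q, 0 < Q &
    forall m x, (m < n)%N -> x \in `[a, b] -> norm1 (c m x) <= Q.
Proof.
move=> ab; elim: n => [|n IH] cc; first by exists 1.
have [|Q Q0 cQ] := IH; first by move=> m mn; apply: cc; exact: ltnW.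
have [k k0 ck] := continuous_bounded ab (ccontinuous_norm1 (cc n (ltnSn n))).
exists (Q + k); first exact: addr_gt0.
move=> m x; rewrite ltnS leq_eqVlt => /predU1P[->|mn] xN.
  by rewrite -[leLHS]ger0_norm ?norm1_ge0// (le_trans (ck x xN))// lerDr ltW.
by rewrite (le_trans (cQ m x mn xN))// lerDl ltW.
Qed.

(** The constant depends only on the length of the interval on which
    [monic_op_bound_short] is applied, so that length can be fixed once the
    coefficients are bounded; every point of [`[- N, N]] lies in an interval of
    that length. *)
Lemma monic_op_bound (c : nat -> R -> C) N : 0 < N ->
  (forall m, (m < M)%N -> ccontinuous (c m)) ->
  exists2 K, 0 < K & forall h B, Cn M h ->
    L1_le (- N) N (fun x => norm1 (h x)) B ->
    L1_le (- N) N (fun x => norm1 (monic_op c h x)) B ->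
    forall m x, (m < M)%N -> x \in `[- N, N] ->
      norm1 (cderiven m h x) <= K * B.
Proof.
move=> N0 cc; have NN : - N <= N by lra.
have [Q Q0 cQ] := coefs_bounded NN cc.
have NV0 : 0 < N^-1 by rewrite invr_gt0.
have MQ0 : 0 <= M%:R * Q by rewrite mulr_ge0// ltW.
(* The length [T^-1] is at most 1, fits into half of [`[- N, N]], and is small
   enough for the absorption. *)
pose T := 1 + N^-1 + 4 * (M%:R * Q); have T0 : 0 < T by rewrite /T; lra.
pose d := T^-1; have d0 : 0 < d by rewrite invr_gt0.
have d1 : d <= 1 by rewrite /d invf_le1// /T; lra.
have dN : d <= N by rewrite /d -[leRHS]invrK lef_pV2// /T; lra.
have small : M%:R * Q * d <= 4^-1 by rewrite ler_pdivrMr// /T; lra.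
exists (4 * interp_sum 0 M d + 4).
  by have := interp_sum_ge0 0 M d0; lra.
move=> h B hC hB LB m x mM xN.
have on_short a : - N <= a -> a + d <= N -> x \in `[a, a + d] ->
    norm1 (cderiven m h x) <= (4 * interp_sum 0 M d + 4) * B.
  move=> Na adN xa.
  have adE : a + d - a = d by lra.
  have -> : (4 * interp_sum 0 M d + 4) * B =
      4 * interp_sum 0 M (a + d - a) * B + 4 * B by rewrite adE mulrDl.
  apply: (@monic_op_bound_short c h a (a + d) Q) => //; rewrite ?adE//.
  - by lra.
  - exact: ltW.
  - move=> k y kM; rewrite in_itv/= => /andP[ay yb]; apply: cQ => //.
    by rewrite in_itv/=; lra.
  - exact: L1_le_sub hB.
  - exact: L1_le_sub LB.
move: xN; rewrite in_itv/= => /andP[Nx xN].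
have [x0|x0] := leP x 0.
  by apply: (on_short x); rewrite ?in_itv/=; lra.
by apply: (on_short (x - d)); rewrite ?in_itv/=; lra.
Qed.

End APrioriEstimate.

(** * Limits of functions and of their derivatives *)

Section Limits.
Variable R : realType.
Local Notation mu := (@lebesgue_measure R).
Implicit Types (a b x e K N : R) (G H : R -> R).

Lemma exists_small_rate K e : 0 < e -> exists n : nat, K * n.+1%:R^-1 <= e.
Proof.
move=> e0; have [K0|K0] := leP K 0.
  by exists 0; apply: le_trans (ltW e0); rewrite mulr_le0_ge0.
have [n] := ltr_add_invr (divr_gt0 e0 K0).
rewrite add0r => ne; exists n.
by rewrite mulrC -ler_pdivlMr// ltW.
Qed.

Lemma rate_decr K (n k : nat) : 0 <= K -> (n <= k)%N ->
  K * k.+1%:R^-1 <= K * n.+1%:R^-1.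
Proof. by move=> K0 nk; rewrite ler_wpM2l// lef_pV2 ?posrE// ler_nat. Qed.

Lemma cauchy_rate_lim (u : nat -> R) K : 0 <= K ->
  (forall n k, (n <= k)%N -> `|u n - u k| <= K * n.+1%:R^-1) ->
  forall n, `|u n - lim (u @ \oo)| <= K * n.+1%:R^-1.
Proof.
move=> K0 uK n.
have cu : cvg (u @ \oo).
  apply/cauchy_cvgP/cauchy_exP => e e0.
  have e20 : 0 < e / 2 by rewrite divr_gt0.
  have [m me] := exists_small_rate K e20.
  exists (u m); exists m => // k /= mk.
  rewrite /ball/=; apply: le_lt_trans (uK m k mk) _.
  by apply: le_lt_trans me _; rewrite ltr_pdivrMr//; lra.
apply/ler_addgt0Pr => e e0.
have /cvgrPdist_lt/(_ _ e0)[m _ um] := cu.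
have := um (maxn m n) (leq_maxl _ _).
have := uK n (maxn m n) (leq_maxr _ _).
move=> /= un ul; rewrite -(subrKA (u (maxn m n))).
by rewrite (le_trans (ler_normD _ _))// lerD// distrC ltW.
Qed.

Lemma uniform_limit_continuous G :
  (forall N e, 0 < N -> 0 < e -> exists2 u : R -> R, continuous u &
    forall x, x \in `[- N, N] -> `|u x - G x| <= e) -> continuous G.
Proof.
move=> GN x; apply/cvgrPdist_lt => e e0.
have N0 : 0 < `|x| + 1 by rewrite ltr_wpDl.
have e40 : 0 < e / 4 by rewrite divr_gt0.
have [u cu uG] := GN _ _ N0 e40.
have inN y : `|x - y| < 1 -> y \in `[- (`|x| + 1), `|x| + 1].
  move=> xy; rewrite -[y \in _]/(_ \in _) in_itv/= -ler_norml.
  rewrite -[y](subKr x) (le_trans (ler_normB _ _))// lerD2l.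
  exact: ltW.
have /cvgrPdist_lt/(_ _ e40) ux := cu x.
have near1 : \forall y \near x, `|x - y| < 1.
  exact: (@cvgr_dist_lt _ _ _ (nbhs x) _ id x cvg_id 1 ltr01).
near=> y.
have xy1 : `|x - y| < 1.
  by near: y; exact: near1.
have uxy : `|u x - u y| < e / 4 by near: y.
have xx := uG x (inN x _); have yy := uG y (inN y xy1).
move: xx; rewrite subrr normr0 => /(_ ltr01).
move: yy uxy; rewrite !ler_norml !ltr_norml; lra.
Unshelve. all: by end_near. Qed.

(** If [Phi] is a primitive of [H], the increments of [u - Phi] are bounded by
    the integral of [u' - H], so those of its limit [G - Phi] vanish. *)
Lemma limit_is_derive a b G H : continuous H ->
  (forall e, 0 < e -> exists u : R -> R, [/\ forall x, derivable u x 1,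
     continuous (derive1 u),
     forall x, x \in `[a, b] -> `|u x - G x| <= e &
     L1_le a b (derive1 u \- H) e]) ->
  forall x, a < x < b -> is_derive x 1 G (H x).
Proof.
move=> cH uG x0 /andP[ax0 x0b].
(* Starting the integral at [a - 1] makes [Phi] differentiable at [a] too. *)
pose Phi t := (\int[mu]_(s in `[(a - 1)%R, t]) H s)%R.
have dPhi x : x \in `[a, b] -> is_derive x 1 Phi (H x).
  rewrite in_itv/= => /andP[ax xb].
  have xb1 : x < b + 1 by lra.
  have iH : mu.-integrable `[(a - 1)%R, (b + 1)%R] (EFin \o H).
    apply: continuous_compact_integrable; first exact: segment_compact.
    exact: continuous_subspaceT.
  have a1x : a - 1 < x by lra.
  have [dP PE] := continuous_FTC1_closed xb1 iH a1x (cH x).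
  by apply: DeriveDef => //; rewrite -PE derive1E.
clearbody Phi.
have cst_le x y : x \in `[a, b] -> y \in `[a, b] -> x <= y ->
    G y - G x = Phi y - Phi x.
  move=> xab yab xy; apply/eqP; rewrite -subr_eq0 -normr_le0.
  apply/ler_addgt0Pr => e e0; rewrite add0r.
  have e30 : 0 < e / 3 by rewrite divr_gt0.
  have [u [du cu uGe uH]] := uG _ e30.
  have := uGe x xab; have := uGe y yab.
  have sub z : z \in `[x, y] -> z \in `[a, b].
    by move: xab yab; rewrite !in_itv/= => /andP[? ?] /andP[? ?] /andP[? ?]; lra.
  have du' z : z \in `[x, y] -> is_derive z 1 (u - Phi) (derive1 u z - H z).
    move=> /sub zab; apply: is_deriveB; last exact: dPhi.
    by apply: DeriveDef; [exact: du|rewrite derive1E].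
  have cuH : continuous (derive1 u \- H).
    by move=> z; apply: cvgB; [exact: cu|exact: cH].
  have L : L1_le x y (derive1 u \- H) (e / 3).
    apply: L1_le_sub uH; move: xab yab; rewrite !in_itv/=;
      by move=> /andP[? ?] /andP[? ?].
  have := ftc_le xy du' cuH L.
  rewrite -[X in `|X|]/((u y - Phi y) - (u x - Phi x)).
  rewrite !ler_norml; lra.
have x0ab : x0 \in `[a, b] by rewrite in_itv/=; lra.
apply: (@near_eq_is_derive _ _ _ (Phi + cst (G x0 - Phi x0))); last first.
  by rewrite -[H x0]addr0; apply: is_deriveD; exact: dPhi.
have : \forall y \near x0, y \in `]a, b[.
  by apply: near_in_itvoo; rewrite in_itv/= ax0.
apply: filterS => y /subset_itv_oo_cc yab.
rewrite -[LHS]/(Phi y + (G x0 - Phi x0)).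
have /orP[xy|yx] := le_total x0 y.
  by have := cst_le x0 y x0ab yab xy; lra.
by have := cst_le y x0 yab x0ab yx; lra.
Qed.

End Limits.

(** * The kernel of a monic operator is closed *)

Section ClosedKernel.
Variables (R : realType) (M : nat).
Local Notation C := R[i].
Local Notation mu := (@lebesgue_measure R).
Implicit Types (a b x N K : R).

Lemma Cn_continuous (h : R -> C) n : Cn n h -> ccontinuous h.
Proof.
by move=> [hr hj]; split;
  [exact: real_Cn_cont hr (leq0n n)|exact: real_Cn_cont hj (leq0n n)].
Qed.

Lemma monic_opB c (h g : R -> C) x : Cn M h -> Cn M g ->
  monic_op M c (fun t => h t - g t) x = monic_op M c h x - monic_op M c g x.
Proof.
move=> hC gC; have [E _] := CnB hC gC.
rewrite /monic_op opprD addrACA -E//; congr (_ + _).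
rewrite -sumrB; apply: eq_bigr => m _.
by rewrite E ?mulrBr//; exact: ltnW.
Qed.

Lemma monic_op_ccontinuous c (h : R -> C) :
  (forall m, (m < M)%N -> ccontinuous (c m)) -> Cn M h ->
  ccontinuous (monic_op M c h).
Proof.
move=> cc hC; apply: ccontinuousD; last exact: Cn_ccontinuous hC _.
apply: ccontinuous_sum => m; apply: ccontinuousM; first exact: cc.
by apply: Cn_ccontinuous hC _; exact: ltnW.
Qed.

Lemma cderivenE n (G : nat -> R -> C) :
  (forall m x, (m < n)%N ->
    is_derive x 1 (fun t => complex.Re (G m t)) (complex.Re (G m.+1 x)) /\
    is_derive x 1 (fun t => complex.Im (G m t)) (complex.Im (G m.+1 x))) ->
  ccontinuous (G n) ->
  Cn n (G 0%N) /\ forall m x, (m <= n)%N -> cderiven m (G 0%N) x = G m x.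
Proof.
move=> dG [rc jc].
have E m : (m <= n)%N ->
    derive1n m (fun t => complex.Re (G 0%N t)) = (fun t => complex.Re (G m t)) /\
    derive1n m (fun t => complex.Im (G 0%N t)) = (fun t => complex.Im (G m t)).
  elim: m => [//|m IH] mn; have [IHr IHj] := IH (ltnW mn).
  rewrite !derive1nS IHr IHj; split; apply/funext => x; rewrite derive1E.
    exact: (@derive_val _ _ _ _ _ _ _ (dG m x mn).1).
  exact: (@derive_val _ _ _ _ _ _ _ (dG m x mn).2).
split.
  split; split; rewrite ?(E n (leqnn _)).1 ?(E n (leqnn _)).2 // => k x kn.
    by rewrite (E k (ltnW kn)).1; have [[]] := dG k x kn.
  by rewrite (E k (ltnW kn)).2; have [_ []] := dG k x kn.
move=> m x mn; rewrite /cderiven (E m mn).1 (E m mn).2.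
by case: (G m x).
Qed.

Section Limit.
Variables (c : nat -> R -> C) (f : R -> C) (h : nat -> R -> C).
Hypothesis M0 : (0 < M)%N.
Hypothesis cc : forall m, (m < M)%N -> ccontinuous (c m).
Hypothesis mf : measurable_complex f.
Hypothesis hC : forall n, Cn M (h n).
Hypothesis hf : forall N, 0 < N -> exists K, forall n,
  L1_le (- N) N (fun x => norm1 (h n x - f x)) (K * n.+1%:R^-1) /\
  L1_le (- N) N (fun x => norm1 (monic_op M c (h n) x)) (K * n.+1%:R^-1).

(* Side conditions on the rate are discharged by [//] from the context. *)
Let rate_ge0 n : 0 <= n.+1%:R^-1 :> R.
Proof. by rewrite invr_ge0. Qed.

Lemma derivs_cauchy N : 0 < N -> exists2 K, 0 <= K & forall n k m x,
  (n <= k)%N -> (m < M)%N -> x \in `[- N, N] ->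
  norm1 (cderiven m (h n) x - cderiven m (h k) x) <= K * n.+1%:R^-1.
Proof.
move=> N0; have [K hK] := hf N0.
have [K' K'0 apriori] := monic_op_bound N0 cc.
have K0 : 0 <= K by have := L1_le_ge0 (hK 0%N).1; rewrite invr1 mulr1.
exists (K' * (2 * K)); first by rewrite !mulr_ge0// ltW.
move=> n k m x nk mM xN; have [DE DC] := CnB (hC n) (hC k).
have double (u v : R -> R) : L1_le (- N) N u (K * n.+1%:R^-1) ->
    L1_le (- N) N v (K * k.+1%:R^-1) ->
    L1_le (- N) N (fun x => `|u x| + `|v x|) (2 * K * n.+1%:R^-1).
  move=> uK vK; apply: L1_le_widen (L1_leD uK vK).
  by rewrite -mulrA mulr_natl mulr2n lerD2l rate_decr.
rewrite -DE; last exact: ltnW.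
rewrite -mulrA; apply: apriori => //.
  apply: L1_le_mono (double _ _ (hK n).1 (hK k).1).
    apply: measurable_norm1; apply: ccontinuous_measurable.
    exact: Cn_continuous DC.
  move=> y _; rewrite [leRHS]ger0_norm ?addr_ge0// !ger0_norm ?norm1_ge0//.
  have -> : h n y - h k y = (h n y - f y) - (h k y - f y).
    by rewrite opprB addrA subrK.
  exact: norm1B.
apply: L1_le_mono (double _ _ (hK n).2 (hK k).2).
  apply: measurable_norm1; apply: ccontinuous_measurable.
  exact: monic_op_ccontinuous.
move=> y _; rewrite [leRHS]ger0_norm ?addr_ge0// !ger0_norm ?norm1_ge0//.
by rewrite monic_opB// norm1B.
Qed.

Let g m x : C :=
  Complex (lim ((fun n => complex.Re (cderiven m (h n) x)) @ \oo))
          (lim ((fun n => complex.Im (cderiven m (h n) x)) @ \oo)).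

Lemma derivs_cvg N : 0 < N -> exists2 K, 0 <= K & forall n m x,
  (m < M)%N -> x \in `[- N, N] ->
  norm1 (cderiven m (h n) x - g m x) <= K * n.+1%:R^-1.
Proof.
move=> N0; have [K K0 cauchy] := derivs_cauchy N0.
exists (K + K); first exact: addr_ge0.
move=> n m x mM xN; rewrite mulrDl /norm1 ReB ImB.
apply: lerD.
  apply: (@cauchy_rate_lim R
    (fun n => complex.Re (cderiven m (h n) x))) => // i k ik.
  by rewrite -ReB (le_trans _ (cauchy i k m x ik mM xN))// Re_le_norm1.
apply: (@cauchy_rate_lim R
    (fun n => complex.Im (cderiven m (h n) x))) => // i k ik.
by rewrite -ImB (le_trans _ (cauchy i k m x ik mM xN))// Im_le_norm1.
Qed.

Lemma limit_ccontinuous m : (m < M)%N -> ccontinuous (g m).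
Proof.
move=> mM; split; apply: uniform_limit_continuous => N e N0 e0;
  have [K K0 gK] := derivs_cvg N0; have [n ne] := exists_small_rate K e0.
  exists (fun t => complex.Re (cderiven m (h n) t)).
    by have [] := Cn_ccontinuous (hC n) (ltnW mM).
  move=> x xN; rewrite -ReB (le_trans (Re_le_norm1 _))//.
  exact: le_trans (gK n m x mM xN) ne.
exists (fun t => complex.Im (cderiven m (h n) t)).
  by have [] := Cn_ccontinuous (hC n) (ltnW mM).
move=> x xN; rewrite -ImB (le_trans (Im_le_norm1 _))//.
exact: le_trans (gK n m x mM xN) ne.
Qed.

(** The candidate for the derivative of order [m] of the limit; for [m = M] it
    is the value that the equation [monic_op M c g = 0] prescribes. *)
Let G m x : C := if (m < M)%N then g m x else - \sum_(k < M) c k x * g k x.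

Lemma candidate_ccontinuous m : ccontinuous (G m).
Proof.
rewrite /G; case: (ltnP m M) => [/limit_ccontinuous//|_].
apply: ccontinuousN; apply: ccontinuous_sum => k.
by apply: ccontinuousM; [exact: cc|exact: limit_ccontinuous].
Qed.

(** In order [M] the difference is [monic_op M c (h n)] minus a combination of
    the lower differences, which converge uniformly. *)
Lemma derivs_L1_cvg N : 0 < N -> exists K, forall n m, (m < M)%N ->
  L1_le (- N) N (fun x => norm1 (cderiven m.+1 (h n) x - G m.+1 x))
    (K * n.+1%:R^-1).
Proof.
move=> N0; have NN : - N <= N by lra.
have [K K0 gK] := derivs_cvg N0; have [K' hK] := hf N0.
have [Q Q0 cQ] := coefs_bounded NN cc.
have K'0 : 0 <= K' by have := L1_le_ge0 (hK 0%N).1; rewrite invr1 mulr1.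
have NN0 : 0 <= N - - N by lra.
have {}Q0 := ltW Q0.
have A0 : 0 <= K * (N - - N) by rewrite mulr_ge0.
have B0 : 0 <= M%:R * (Q * K) by rewrite !mulr_ge0.
exists (K * (N - - N) + (K' + M%:R * (Q * K) * (N - - N))) => n m mM.
have mG : measurable_fun [set: R]
    (fun x => norm1 (cderiven m.+1 (h n) x - G m.+1 x)).
  apply: measurable_norm1; apply: measurable_complexB;
    apply: ccontinuous_measurable.
    exact: Cn_ccontinuous (hC n) mM.
  exact: candidate_ccontinuous.
have [mM1|mM1] := ltnP m.+1 M.
  apply: (@L1_le_widen _ _ _ _ (K * n.+1%:R^-1 * (N - - N))).
    by rewrite mulrAC ler_wpM2r// lerDl addr_ge0// mulr_ge0.
  apply: L1_le_bounded => // x xN; rewrite ger0_norm ?norm1_ge0// /G mM1.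
  exact: gK.
have {}mM1 : m.+1 = M by apply/eqP; rewrite eqn_leq mM.
have H := L1_leD (hK n).2 (L1_le_cst (M%:R * (Q * K) * n.+1%:R^-1) NN).
apply: L1_le_widen (L1_le_mono mG _ H).
  rewrite ger0_norm ?mulr_ge0//.
  by rewrite [X in _ + X]mulrAC -mulrDl ler_wpM2r// lerDr.
move=> x xN.
rewrite [leRHS]ger0_norm ?addr_ge0// !ger0_norm ?norm1_ge0//; last first.
  by rewrite /= mulr_ge0.
have -> : cderiven m.+1 (h n) x - G m.+1 x = monic_op M c (h n) x -
    \sum_(m < M) c m x * (cderiven m (h n) x - g m x).
  rewrite /G mM1 ltnn opprK /monic_op.
  under [X in _ = _ - X]eq_bigr do rewrite mulrBr.
  by rewrite sumrB opprB [RHS]addrC [RHS]addrA subrK addrC.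
apply: le_trans (norm1B _ _) _; rewrite lerD2l.
apply: le_trans (norm1_sum _ _ _) _.
apply: (@le_trans _ _ (\sum_(m < M) Q * (K * n.+1%:R^-1))).
  apply: ler_sum => k _; apply: le_trans (norm1M _ _) _.
  by apply: ler_pM; rewrite ?norm1_ge0 ?cQ ?gK.
by rewrite sumr_const card_ord -(mulr_natl (Q * _)) !mulrA.
Qed.

Lemma candidate_is_derive m x : (m < M)%N ->
  is_derive x 1 (fun t => complex.Re (G m t)) (complex.Re (G m.+1 x)) /\
  is_derive x 1 (fun t => complex.Im (G m t)) (complex.Im (G m.+1 x)).
Proof.
move=> mM; pose N := `|x| + 1; have N0 : 0 < N by rewrite ltr_wpDl.
have xN : - N < x < N by rewrite -ltr_norml /N ltrDl.
have [K K0 gK] := derivs_cvg N0; have [K' dK] := derivs_L1_cvg N0.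
have [rg jg] := candidate_ccontinuous m.+1.
have GE : G m = g m by apply/funext => t; rewrite /G mM.
have approx e : 0 < e -> exists n,
    (forall t, t \in `[- N, N] -> norm1 (cderiven m (h n) t - G m t) <= e) /\
    L1_le (- N) N (fun x => norm1 (cderiven m.+1 (h n) x - G m.+1 x)) e.
  move=> e0; have [n ne] := exists_small_rate (K + `|K'|) e0.
  exists n; split=> [t tN|].
    rewrite GE (le_trans (gK n m t mM tN))// (le_trans _ ne)//.
    by rewrite ler_wpM2r// lerDl.
  apply: L1_le_widen (dK n m mM); rewrite (le_trans _ ne)// ler_wpM2r//.
  by rewrite (le_trans (ler_norm _))// lerDr.
clearbody G.
split.
  apply: (@limit_is_derive _ (- N) N _ (fun t => complex.Re (G m.+1 t))) => // e e0.
  have [n [ne ne']] := approx e e0.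
  exists (derive1n m (fun t => complex.Re (h n t))); split.
  - by move=> t; apply: (hC n).1.1.
  - exact: real_Cn_cont (hC n).1 mM.
  - move=> t tN; apply: le_trans (ne t tN).
    by rewrite -[X in `|X|](ReB (cderiven m (h n) t)) Re_le_norm1.
  - apply: L1_le_mono ne'.
      apply: measurable_funB; apply: continuous_measurable => //.
      exact: real_Cn_cont (hC n).1 mM.
    move=> t _; rewrite [leRHS]ger0_norm ?norm1_ge0//.
    by rewrite -[X in `|X|](ReB (cderiven m.+1 (h n) t)) Re_le_norm1.
apply: (@limit_is_derive _ (- N) N _ (fun t => complex.Im (G m.+1 t))) => // e e0.
have [n [ne ne']] := approx e e0.
exists (derive1n m (fun t => complex.Im (h n t))); split.
- by move=> t; apply: (hC n).2.1.
- exact: real_Cn_cont (hC n).2 mM.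
- move=> t tN; apply: le_trans (ne t tN).
  by rewrite -[X in `|X|](ImB (cderiven m (h n) t)) Im_le_norm1.
- apply: L1_le_mono ne'.
    apply: measurable_funB; apply: continuous_measurable => //.
    exact: real_Cn_cont (hC n).2 mM.
  move=> t _; rewrite [leRHS]ger0_norm ?norm1_ge0//.
  by rewrite -[X in `|X|](ImB (cderiven m.+1 (h n) t)) Im_le_norm1.
Qed.

Lemma limit_eq_ae : eq_ae f (G 0%N).
Proof.
have aeN (k : nat) :
    {ae mu, forall x, x \in `[- k.+1%:R, k.+1%:R] -> f x = G 0%N x}.
  set N : R := k.+1%:R; have N0 : 0 < N by rewrite ltr0n.
  have NN : - N <= N by lra.
  have [K K0 gK] := derivs_cvg N0; have [K' hK] := hf N0.
  have c0 := candidate_ccontinuous 0.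
  have md : measurable_complex (fun x => f x - G 0%N x).
    by apply: measurable_complexB => //; exact: ccontinuous_measurable.
  have rate n : L1_le (- N) N (fun x => norm1 (f x - G 0%N x))
      ((K' + K * (N - - N)) * n.+1%:R^-1).
    have nb : L1_le (- N) N (fun x => norm1 (h n x - G 0%N x))
        (K * n.+1%:R^-1 * (N - - N)).
      apply: L1_le_bounded => //.
        apply: measurable_norm1; apply: measurable_complexB;
          apply: ccontinuous_measurable => //.
        exact: Cn_continuous (hC n).
      move=> x xN; rewrite ger0_norm ?norm1_ge0//.
      have := gK n 0%N x M0 xN; rewrite /G M0.
      by rewrite (_ : cderiven 0 (h n) x = h n x)// /cderiven /=; case: (h n x).
    have -> : (K' + K * (N - - N)) * n.+1%:R^-1 =
        K' * n.+1%:R^-1 + K * n.+1%:R^-1 * (N - - N).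
      by rewrite mulrDl; congr (_ + _); rewrite mulrAC.
    apply: L1_le_mono (L1_leD (hK n).1 nb); first exact: measurable_norm1.
    move=> x _; rewrite [leRHS]ger0_norm ?addr_ge0// !ger0_norm ?norm1_ge0//.
    have -> : f x - G 0%N x = (h n x - G 0%N x) - (h n x - f x).
      by rewrite opprB [RHS]addrC [RHS]addrA subrK.
    by rewrite [leRHS]addrC norm1B.
  have [mn _] := rate 0%N.
  have le0 : (\int[mu]_(x in `[(- N)%R, N]) `|norm1 (f x - G 0%N x)|%:E <= 0)%E.
    apply/lee_addgt0Pr => e e0; rewrite add0e.
    have [n ne] := exists_small_rate (K' + K * (N - - N)) e0.
    exact: (L1_le_widen ne (rate n)).2.
  have int0 : (\int[mu]_(x in `[(- N)%R, N])
      `|(norm1 (f x - G 0%N x))%:E| = 0)%E.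
    by apply/eqP; rewrite eq_le le0 integral_ge0.
  have mE : measurable_fun `[(- N)%R, N] (fun x => (norm1 (f x - G 0%N x))%:E).
    by apply/measurable_EFinP; apply: measurable_funS mn.
  have := (ae_eq_integral_abs mu (measurable_itv _) mE).1 int0.
  apply: filterS => x fx xN; have /= := fx xN.
  by move=> [/norm1_eq0/eqP]; rewrite subr_eq0 => /eqP.
have := ae_foralln aeN; apply: filterS => x fx.
have [k xk] := exists_small_rate `|x| (@ltr01 R).
move: xk; rewrite ler_pdivrMr// mul1r => xk.
by apply: (fx k); rewrite in_itv/= -ler_norml.
Qed.

(** The lower derivatives of the [h n] converge locally uniformly by the a priori
    estimate, and the equation then forces the derivatives of order [M] to
    converge in [L1] to the value it prescribes for the limit. *)
Lemma monic_op_kernel_closed :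
  exists g, [/\ Cn M g, eq_ae f g & forall x, monic_op M c g x = 0].
Proof.
have [GC GE] := cderivenE candidate_is_derive (candidate_ccontinuous M).
exists (G 0%N); split => //; first exact: limit_eq_ae.
move=> x; rewrite /monic_op GE// {2}/G ltnn.
apply/eqP; rewrite subr_eq0; apply/eqP; apply: eq_bigr => m _.
by rewrite GE ?(ltnW (ltn_ord m))// /G ltn_ord.
Qed.

End Limit.
End ClosedKernel.

(** * From the weighted norm to local integrals *)

Section WeightedEstimates.
Variables (R : realType) (k0 : int).
Local Notation C := R[i].
Local Notation mu := (@lebesgue_measure R).
Local Notation normc := (@ComplexField.Normc.normc R).
Implicit Types (f g : R -> C) (x N e : R).

Definition weight x : R := (x ^+ 2 + 1) ^ k0.

Lemma weight_base_gt0 x : 0 < x ^+ 2 + 1.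
Proof. by rewrite ltr_wpDl// sqr_ge0. Qed.

Lemma weight_gt0 x : 0 < weight x.
Proof. by rewrite exprz_gt0// weight_base_gt0. Qed.

Lemma continuous_weight : continuous weight.
Proof.
have cX n : continuous (fun x : R => (x ^+ 2 + 1) ^+ n).
  move=> x; have cb : {for x, continuous (fun x : R => x ^+ 2 + 1)}.
    by apply: cvgD; [exact: exprn_continuous|exact: cvg_cst].
  exact: (continuous_comp cb (@exprn_continuous _ n _)).
rewrite /weight; case: k0 => n x; first exact: cX.
by apply: cvgV; [rewrite expf_neq0// gt_eqF// weight_base_gt0|exact: cX].
Qed.

Lemma sqr_normc (z : C) : normc z ^+ 2 = complex.Re z ^+ 2 + complex.Im z ^+ 2.
Proof. by case: z => a b; rewrite /= sqr_sqrtr// addr_ge0// sqr_ge0. Qed.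

Lemma measurable_density f : measurable_complex f ->
  measurable_fun [set: R] (fun x => normc (f x) ^+ 2 * weight x).
Proof.
move=> [rf jf]; apply: measurable_funM; last first.
  exact: continuous_measurable continuous_weight.
under eq_fun do rewrite sqr_normc.
by apply: measurable_funD; exact: measurable_funX.
Qed.

Lemma measurable_densityE f : measurable_complex f ->
  measurable_fun [set: R] (fun x => (normc (f x) ^+ 2 * weight x)%:E).
Proof. by move=> mf; apply/measurable_EFinP; exact: measurable_density. Qed.

Lemma density_ge0 f x : 0 <= normc (f x) ^+ 2 * weight x.
Proof. by rewrite mulr_ge0 ?sqr_ge0// ltW// weight_gt0. Qed.

Lemma sqnorm_ge0 f : (0 <= sqnorm k0 f)%E.
Proof. by apply: integral_ge0 => x _; rewrite lee_fin density_ge0. Qed.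

Lemma eq_ae_sqnorm f g : measurable_complex f -> measurable_complex g ->
  eq_ae f g -> sqnorm k0 f = sqnorm k0 g.
Proof.
move=> mf mg fg; apply: ge0_ae_eq_integral => //.
- exact: measurable_densityE.
- exact: measurable_densityE.
- by move=> x _; rewrite lee_fin density_ge0.
- by move=> x _; rewrite lee_fin density_ge0.
- have [A [mA A0 sA]] := fg; exists A; split=> // x nx.
  by apply: sA => fgx; apply: nx => _ /=; rewrite fgx.
Qed.

Lemma sqnorm0 : sqnorm k0 (fun _ : R => 0) = 0%E.
Proof.
rewrite /sqnorm.
under eq_integral do rewrite ComplexField.Normc.normc0 expr0n/= mul0r.
exact: integral0.
Qed.

Lemma L2Z (z : C) f : L2 k0 f -> L2 k0 (fun x => z * f x).
Proof.
move=> [mf fi]; split.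
  by apply: measurable_complexM => //; apply/ccontinuous_measurable/ccontinuous_cst.
rewrite /sqnorm.
under eq_integral do
  rewrite ComplexField.Normc.normcM exprMn -mulrA EFinM.
rewrite ge0_integralZl_EFin ?sqr_ge0//.
- apply: lte_mul_pinfty; rewrite ?lee_fin ?sqr_ge0//.
- by move=> x _; rewrite lee_fin density_ge0.
- exact: measurable_densityE.
Qed.

Lemma L2_eq_ae f g : measurable_complex g -> eq_ae f g -> L2 k0 f -> L2 k0 g.
Proof. by move=> mg fg [mf fi]; split=> //; rewrite -(eq_ae_sqnorm mf mg fg). Qed.

(** The Cauchy-Schwarz inequality is replaced by [t <= e + t ^+ 2 / e], which is
    integrated with [e] of the size of the norm; the weight is bounded below by
    a positive constant on [`[- N, N]]. *)
Lemma sqnorm_L1_le N : 0 < N -> exists2 K, 0 < K & forall f e,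
  measurable_complex f -> 0 < e -> (sqnorm k0 f <= (e ^+ 2)%:E)%E ->
  L1_le (- N) N (fun x => norm1 (f x)) (K * e).
Proof.
move=> N0; have NN : - N <= N by lra.
have [x0 _ wmin] := EVT_min NN (continuous_subspaceT continuous_weight).
pose w := weight x0; have w0 : 0 < w := weight_gt0 x0.
exists (N - - N + 2 / w).
  by rewrite addr_gt0 ?divr_gt0//; lra.
move=> f e mf e0 fe.
pose s x := normc (f x) ^+ 2 * weight x.
have s_e : L1_le (- N) N s (e ^+ 2).
  split; first exact: measurable_density.
  apply: le_trans fe; rewrite /sqnorm.
  under eq_integral do rewrite ger0_norm ?density_ge0//.
  apply: ge0_subset_integral => //.
    exact: measurable_densityE.
  by move=> x _; rewrite lee_fin density_ge0.
have := L1_leD (L1_le_cst e NN) (L1_leZ (2 / (w * e)) s_e).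
have we0 : 0 < 2 / (w * e) by rewrite divr_gt0// mulr_gt0.
rewrite !gtr0_norm//.
have -> : e * (N - - N) + 2 / (w * e) * e ^+ 2 = (N - - N + 2 / w) * e.
  rewrite [RHS]mulrDl [e * _]mulrC; congr (_ + _).
  by rewrite invfM expr2 !mulrA mulfVK// gt_eqF.
apply: L1_le_mono; first exact: measurable_norm1.
move=> x xN; have sx0 : 0 <= 2 / (w * e) * s x.
  by rewrite mulr_ge0 ?density_ge0// ltW.
rewrite (ger0_norm sx0) !ger0_norm ?norm1_ge0 ?addr_ge0 ?(ltW e0)//.
(* The bound [t <= e + t ^+ 2 / e] for [t := norm1 (f x)], multiplied by [w * e]. *)
have ws : w * normc (f x) ^+ 2 <= s x.
  by rewrite mulrC /s ler_wpM2l ?sqr_ge0// wmin.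
have n2 : norm1 (f x) ^+ 2 <= 2 * normc (f x) ^+ 2.
  rewrite sqr_normc /norm1 -(real_normK (num_real (complex.Re (f x)))).
  rewrite -(real_normK (num_real (complex.Im (f x)))).
  have := sqr_ge0 (`|complex.Re (f x)| - `|complex.Im (f x)|); lra.
have : norm1 (f x) * (w * e) <= e * (w * e) + 2 * s x.
  have := sqr_ge0 (norm1 (f x) - e).
  have := norm1_ge0 (f x).
  move: (norm1 (f x)) (normc (f x) ^+ 2) (s x) n2 ws => t n u n2 ws t0 sq.
  have : w * (t * e) <= w * (e ^+ 2 + t ^+ 2).
    by rewrite ler_pM2l//; have := sqr_ge0 t; have := sqr_ge0 e; lra.
  have : w * t ^+ 2 <= 2 * u.
    apply: le_trans (_ : w * (2 * n) <= _); first by rewrite ler_pM2l.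
    lra.
  lra.
have we : 0 < w * e by rewrite mulr_gt0.
rewrite -ler_pdivlMr// mulrDl mulfK ?gt_eqF//.
by rewrite [X in _ -> _ <= _ + X]mulrAC.
Qed.

End WeightedEstimates.

(** * Clearing the poles *)

Section ClearedEquation.
Variables (R : realType) (M : nat).
Local Notation C := R[i].
Local Notation mu := (@lebesgue_measure R).
Variable r : 'I_M.+1 -> {fraction {poly C}}.
Hypothesis hsing : singular_points r = set0.
Variable lambda : C.
Implicit Types (x : R) (h : R -> C).

Let lx x : C := (lcm_den r).[x%:C%C].
Let px m x : C := (lcm_den r %/ rden (r m) * rnum (r m)).[x%:C%C].
Let ax x : C := (lead_poly r).[x%:C%C].

Lemma lead_neq0 x : ax x != 0.
Proof.
apply/negP => ax0; suff : singular_points r x by rewrite hsing.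
exact: ax0.
Qed.

Lemma lcm_den_eq0 x : lx x = 0 <-> poles r x.
Proof.
split=> [l0|[m pm]]; last first.
  have : rden (r m) %| lcm_den r by exact/dvdp_lcm_den/dvdpp.
  by move=> /divpK lE; rewrite /lx -lE hornerM (eqP pm) mulr0.
have : lcm_den r %| \prod_(m < M.+1) rden (r m).
  by apply/dvdp_lcm_den => m; rewrite (bigD1 m)//= dvdp_mulIl.
move=> /dvdpP[q qE].
have : (\prod_(m < M.+1) rden (r m)).[x%:C%C] == 0.
  by rewrite qE hornerM [X in _ * X]l0 mulr0.
rewrite horner_prod => /prodf_eq0[m _ m0]; by exists m.
Qed.

Lemma lcm_den_reval m x : ~ poles r x -> lx x * reval (r m) x%:C%C = px m x.
Proof.
move=> np; have dx : (rden (r m)).[x%:C%C] != 0.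
  by apply/negP => d0; apply: np; exists m.
have : rden (r m) %| lcm_den r by exact/dvdp_lcm_den/dvdpp.
move=> /divpK lE; rewrite /lx /px /reval -{1}lE !hornerM.
by rewrite -mulrA; congr (_ * _); rewrite mulrCA mulfV// mulr1.
Qed.

(** Multiplying [R f = lambda f] by [l] clears the poles, and dividing by
    [l * r_M], which has no real zeros, makes the equation monic. The eigenvalue
    is moved into the coefficient of order 0, so that solutions become elements
    of a kernel. *)
Definition cleared_coef (m : nat) x : C :=
  (px (inord m) x - (if m == 0%N then lambda * lx x else 0)) / ax x.

Lemma cleared_coef_ccontinuous m : ccontinuous (cleared_coef m).
Proof.
apply: ccontinuousM; last first.
  by apply: ccontinuousV; [exact: ccontinuous_horner|exact: lead_neq0].
apply: ccontinuousD; first exact: ccontinuous_horner.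
apply: ccontinuousN; case: (m == 0%N); last exact: ccontinuous_cst.
by apply: ccontinuousM; [exact: ccontinuous_cst|exact: ccontinuous_horner].
Qed.

Definition clearing_factor x : C := lx x / ax x.

Lemma clearing_factor_ccontinuous : ccontinuous clearing_factor.
Proof.
apply: ccontinuousM; first exact: ccontinuous_horner.
by apply: ccontinuousV; [exact: ccontinuous_horner|exact: lead_neq0].
Qed.

Lemma clearing_factor_neq0 x : ~ poles r x -> clearing_factor x != 0.
Proof.
move=> np; rewrite /clearing_factor mulf_neq0 ?invr_eq0 ?lead_neq0//.
by apply/eqP => /lcm_den_eq0.
Qed.

Lemma cleared_opE h x : (0 < M)%N -> ~ poles r x ->
  monic_op M cleared_coef h x =
  clearing_factor x * (diffop r h x - lambda * h x).
Proof.
move=> M0 np; have a0 := lead_neq0 x.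
have h0 : cderiven 0 h x = h x by rewrite /cderiven /=; case: (h x).
(* Only the term of order 0 contains the eigenvalue. *)
have lowest : \sum_(m < M) (if val m == 0%N then lambda * lx x else 0) / ax x *
    cderiven m h x = clearing_factor x * (lambda * h x).
  case: M M0 => // n _; rewrite big_ord_recl/= big1 ?addr0.
    by rewrite h0 /clearing_factor; ring.
  by move=> i _; rewrite !mul0r.
rewrite mulrBr -lowest /diffop big_ord_recr/= mulrDr mulr_sumr.
rewrite addrAC -sumrB /monic_op; congr (_ + _).
  apply: eq_bigr => m _; rewrite /cleared_coef mulrBl mulrBl; congr (_ - _).
  have -> : inord m = widen_ord (leqnSn M) m.
    by apply/val_inj; rewrite /= inordK// ltnS ltnW.
  by rewrite -lcm_den_reval// /clearing_factor; ring.
rewrite mulrA; have -> : clearing_factor x * reval (r ord_max) x%:C%C = 1.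
  by rewrite /clearing_factor mulrAC lcm_den_reval// mulfV.
by rewrite mul1r.
Qed.

Lemma ae_not_poles : {ae mu, forall x, ~ poles r x}.
Proof.
have lcm0 : lcm_den r != 0.
  apply/eqP => l0.
  have : lcm_den r %| \prod_(m < M.+1) rden (r m).
    by apply/dvdp_lcm_den => m; rewrite (bigD1 m)//= dvdp_mulIl.
  rewrite l0 dvd0p prodf_seq_eq0 => /hasP[m _].
  by rewrite /= (negbTE (rden_neq0 _)).
have [s sE] := closed_field_poly_normal (lcm_den r).
exists [set` map (@complex.Re R) s]; split.
- exact/countable_measurable/finite_set_countable/finite_seq.
- exact/countable_lebesgue_measure0/finite_set_countable/finite_seq.
move=> x /= np; have /lcm_den_eq0 : poles r x by apply: contrapT.
rewrite /lx sE hornerZ => /eqP; rewrite mulf_eq0 lead_coef_eq0 (negbTE lcm0)/=.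
rewrite horner_prod prodf_seq_eq0 => /hasP[z zs].
rewrite /= hornerXsubC subr_eq0 => /eqP zE.
by apply/mapP; exists z => //; rewrite -zE.
Qed.

End ClearedEquation.

(** * Eigenfunctions of the closure *)

Theorem theorem2p1 (R : realType) (M : nat) (hM : (1 <= M)%N)
    (r : 'I_M.+1 -> {fraction {poly R[i]}})
    (hr : r ord_max != 0)
    (hsing : singular_points r = set0)
    (k0 : int) (lambda : R[i])
    (f : R -> R[i]) (hf : L2 k0 f) (hf0 : ~ eq_ae f (fun=> 0)) :
  eigenfunction k0 (graph_op k0 r) lambda f <->
  exists g : R -> R[i],
    [/\ eq_ae f g, Cn M g, L2 k0 g &
        forall x : R, ~ poles r x -> diffop r g x = lambda * g x].
Proof.
have np := ae_not_poles r.
split=> [[_ _ [_ Llf approx]]|[g [fg gC Lg Rg]]]; last first.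
  split=> //; split=> //=; first exact: L2Z.
  move=> e e0; exists (f, fun x => lambda * f x).
    split=> //=; first exact: L2Z.
    exists g; split=> //=.
    by apply: (ae_mono2 fg np) => x -> /Rg ->.
  have sub0 (u : R -> R[i]) : sqnorm k0 (u \- u) = 0%E.
    have -> : u \- u = (fun=> 0) by apply/funext => x; rewrite /= subrr.
    exact: sqnorm0.
  by rewrite /= !sub0 adde0 lte_fin exprn_gt0.
have [mf _] := hf.
pose e n : R := n.+1%:R^-1; have e0 n : 0 < e n by rewrite invr_gt0.
have /choice[v vP] : forall n : nat,
    exists v : (R -> R[i]) * (R -> R[i]) * (R -> R[i]),
    [/\ L2 k0 v.1.1, L2 k0 v.1.2, Cn M v.2, eq_ae v.1.1 v.2 &
        [/\ eq_ae v.1.2 (diffop r v.2),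
            (sqnorm k0 (f \- v.1.1)%R <= (e n ^+ 2)%:E)%E &
            (sqnorm k0 ((fun x => lambda * f x) \- v.1.2)%R <= (e n ^+ 2)%:E)%E]].
  move=> n; have [[v1 v2] [/= L1 L2' [h [hC vh Rvh]]] small] := approx _ (e0 n).
  exists (v1, v2, h); split=> //; split=> //=; apply: le_trans (ltW small).
    by rewrite leeDl ?sqnorm_ge0.
  by rewrite leeDr ?sqnorm_ge0.
pose h n := (v n).2.
have hC n : Cn M (h n) by have [] := vP n.
pose c := cleared_coef r lambda.
have cc m : ccontinuous (c m) by exact: cleared_coef_ccontinuous.
have [|g [gC fg g0]] :=
  @monic_op_kernel_closed R M c f h hM (fun m _ => cc m) mf hC.
  move=> N N0; have NN : - N <= N by lra.
  have [K K0 L1K] := sqnorm_L1_le k0 N0.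
  have [Q Q0 cQ] := @coefs_bounded R 1 (fun=> clearing_factor r) _ _ NN
    (fun m _ => clearing_factor_ccontinuous hsing).
  exists (K + Q * (K + norm1 lambda * K)) => n.
  have [[m1 _] [m2 _] _ vh [Rvh s1 s2]] := vP n.
  have n0 := norm1_ge0 lambda; have en := ltW (e0 n).
  have f1 := L1K _ _ (measurable_complexB mf m1) (e0 n) s1.
  have f2 := L1K _ _ (measurable_complexB Llf.1 m2) (e0 n) s2.
  split.
    apply: (@L1_le_widen _ _ _ _ (K * e n)).
      by rewrite ler_wpM2r// lerDl mulr_ge0 ?addr_ge0 ?mulr_ge0// ltW.
    apply: L1_le_ae f1.
      apply: measurable_norm1; apply: measurable_complexB => //.
      by apply: ccontinuous_measurable; exact: Cn_continuous (hC n).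
    by apply: (ae_mono2 vh np) => x vhx _ _; rewrite /h -vhx norm1_distC.
  have := L1_leZ Q (L1_leD f2 (L1_leZ (norm1 lambda) f1)).
  rewrite !ger0_norm//; last exact: ltW.
  move=> H; apply: (@L1_le_widen _ _ _ _
    (Q * (K * e n + norm1 lambda * (K * e n)))).
    rewrite -/(e n); have -> : (K + Q * (K + norm1 lambda * K)) * e n =
        K * e n + Q * (K * e n + norm1 lambda * (K * e n)) by ring.
    by rewrite lerDr mulr_ge0// ltW.
  apply: L1_le_ae H.
    apply: measurable_norm1; apply: ccontinuous_measurable.
    exact: monic_op_ccontinuous.
  apply: (ae_mono2 (ae_mono2 vh Rvh (fun x vx Rx => conj vx Rx)) np).
  move=> x [vx Rx] npx xN; rewrite cleared_opE// /h -Rx -vx.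
  have -> : (v n).1.2 x - lambda * (v n).1.1 x =
      lambda * (f x - (v n).1.1 x) - (lambda * f x - (v n).1.2 x) by ring.
  rewrite ger0_norm ?norm1_ge0// [leRHS]ger0_norm; last first.
    by rewrite mulr_ge0 ?addr_ge0// ltW.
  apply: le_trans (norm1M _ _) _; apply: ler_pM; rewrite ?norm1_ge0//.
    exact: (cQ 0%N).
  rewrite !ger0_norm ?mulr_ge0 ?norm1_ge0// [leRHS]addrC.
  apply: le_trans (norm1B _ _) _.
  by rewrite lerD2r norm1M.
exists g; split=> //.
  apply: L2_eq_ae fg hf; apply: ccontinuous_measurable; exact: Cn_continuous gC.
move=> x npx; apply/eqP; rewrite -subr_eq0; apply/eqP.
have := g0 x; rewrite cleared_opE// => /eqP; rewrite mulf_eq0.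
by rewrite (negbTE (clearing_factor_neq0 hsing npx))/= => /eqP.
Qed.
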